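(* Assume $n\ge 3$. Let $M$ be an $n$-compartment cycle model with at least one input, at least one output, and at most one leak (i.e. $|In|\ge1$, $|Out|\ge1$, $|Leak|\le1$). Then $M$ is generically locally identifiable.
   Context: A linear compartmental model $(G,In,Out,Leak)$ consists of a directed graph $G=(V,E)$ with $V=\{1,\dots,n\}$ (vertices are called compartments) and subsets $In,Out,Leak\subseteq V$. Each edge $j\to i$ has a parameter $k_{ij}$, and each $j\in Leak$ has a parameter $k_{0j}$. The compartmental matrix $A$ is the $n\times n$ matrix with off-diagonal entries $A_{ij}=k_{ij}$ if $j\to i\in E$ and $0$ otherwise, and diagonal entries $A_{ii}=-\sum_{p:\,i\to p\in E}k_{pi}$ if $i\notin Leak$, $A_{ii}=-k_{0i}-\sum_{p:\,i\to p\in E}k_{pi}$ if $i\in Leak$. Let $\partial I$ be the $n\times n$ diagonal matrix with all diagonal entries the differential operator $d/dt$, and let $(B)_{ji}$ denote $B$ with row $j$ and column $i$ removed. The input-output equations are, for $i\in Out$, $$\det(\partial I-A)\,y_i=\sum_{j\in In}(-1)^{i+j}\det\big((\partial I-A)_{ji}\big)\,u_j ,$$ with both sides expanded in powers of $d/dt$ (i.e., in derivatives of the $y_i$ and $u_j$). The coefficient map $c:\mathbb{R}^{|E|+|Leak|}\to\mathbb{R}^m$ sends the vector of parameters to the vector of all non-monic coefficients of these equations (coefficients identically equal to $1$ are omitted, as are coefficients identically $0$). A strongly connected model with at least one input is generically locally identifiable if, outside a set of measure zero, every point of $\mathbb{R}^{|E|+|Leak|}$ has an open neighborhood $U$ such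 that $c|_U$ is one-to-one. An $n$-compartment cycle model is a linear compartmental model whose graph $G$ is the directed cycle with edges $1\to2\to3\to\cdots\to n\to1$ (parameters $k_{21},k_{32},\dots,k_{n,n-1},k_{1n}$). *)

(* Defs.v *)
From HB Require Import structures.
From mathcomp Require Import all_boot all_order all_algebra.
From mathcomp Require Import all_classical all_reals all_analysis.

Set Implicit Arguments.
Unset Strict Implicit.
Unset Printing Implicit Defensive.

Import Order.TTheory GRing.Theory Num.Theory.
Import numFieldNormedType.Exports.

Local Open Scope classical_set_scope.
Local Open Scope ring_scope.

(* The compartments 1, ..., n are represented by 0, ..., n-1 in 'I_n.  The
   pair (j, i) in [edges] is the edge j -> i.  A single edge set is used, so
   there are no multiple edges. *)
Record compartmental_model (n : nat) := CompartmentalModel {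
  edges : {set 'I_n * 'I_n};
  In : {set 'I_n};
  Out : {set 'I_n};
  Leak : {set 'I_n} }.

Section Model.
Variables (n : nat) (M : compartmental_model n).

Definition strongly_connected : Prop :=
  forall i j : 'I_n, connect (fun x y => (x, y) \in edges M) i j.

Definition cycle_model : Prop := edges M = [set (i, ordS i) | i : 'I_n]%SET.

Definition param : finType :=
  ({e : 'I_n * 'I_n | e \in edges M} + {j : 'I_n | j \in Leak M})%type.

Section Coefficients.
Variable R : realType.
Implicit Types (v : 'rV[R]_#|param|) (i j : 'I_n).

(* [edge_param v i j] is k_{ij}, the parameter of the edge j -> i; by
   convention it is 0 when j -> i is not an edge. *)
Definition edge_param v i j : R :=
  if insub (j, i) is Some e then v 0 (enum_rank (inl e : param)) else 0.

(* k_{0j}, by convention 0 when j has no leak *)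
Definition leak_param v j : R :=
  if insub j is Some l then v 0 (enum_rank (inr l : param)) else 0.

Definition compartmental_matrix v : 'M[R]_n :=
  \matrix_(i, j)
    if i == j then - leak_param v i - \sum_(p | (i, p) \in edges M) edge_param v p i
    else edge_param v i j.

(* The polynomial variable 'X stands for d/dt, so that
   [char_poly_mx A = 'X%:M - A] is the matrix of the operator (∂I - A). *)
Definition output_poly v : {poly R} :=
  \det (char_poly_mx (compartmental_matrix v)).

Definition input_poly v i j : {poly R} :=
  (-1) ^+ (i + j) *
    \det (row' j (col' i (char_poly_mx (compartmental_matrix v)))).

(* A coefficient is addressed by a triple (i, s, d), where i is an output
   and d the order of the derivative: the case s = None is the coefficient of
   y_i^(d) on the left-hand side of the equation of i, and the case s = Some j
   is the coefficient of u_j^(d) on its right-hand side. *)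
Definition coef_address : finType := ('I_n * option 'I_n * 'I_n.+1)%type.

Definition io_coef v (q : coef_address) : R :=
  let: (i, s, d) := q in
  (if s is Some j then input_poly v i j else output_poly v)`_d.

Definition occurs (q : coef_address) : bool :=
  let: (i, s, _) := q in
  (i \in Out M) && (if s is Some j then j \in In M else true).

Definition coef_index : {set coef_address} :=
  [set q | [&& occurs q, ~~ `[< forall v, io_coef v q = 0 >]
             & ~~ `[< forall v, io_coef v q = 1 >] ]]%SET.

Definition coefficient_map v : 'rV[R]_#|coef_index| :=
  \row_r io_coef v (enum_val r).

End Coefficients.
End Model.

(* Lebesgue-null subsets of R^m: for every e > 0 the set is covered by
   countably many closed boxes of total volume at most e.  The predicate D
   allows finite, possibly empty, families (needed when m = 0). *)
Definition lebesgue_null (R : realType) (m : nat) (N : set 'rV[R]_m) : Prop :=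
  forall e : R, 0 < e ->
  exists (D : pred nat) (a b : nat -> 'rV[R]_m),
    [/\ forall k i, D k -> a k 0 i <= b k 0 i,
        N `<=` \bigcup_(k in [set k | D k])
                 [set x : 'rV[R]_m | forall i, a k 0 i <= x 0 i <= b k 0 i]
      & (\sum_(0 <= k <oo | D k) (\prod_i (b k 0 i - a k 0 i))%:E <= e%:E)%E].

(* The notion is only defined for strongly connected models with at least one
   input, so these two conditions are made part of it. *)
Definition generically_locally_identifiable (R : realType) (n : nat)
    (M : compartmental_model n) : Prop :=
  [/\ strongly_connected M, (1 <= #|In M|)%N &
      exists N : set 'rV[R]_#|param M|, lebesgue_null N /\
        forall v, ~ N v -> exists U : set 'rV[R]_#|param M|,
          [/\ open U, U v & set_inj U (@coefficient_map n M R)]].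

(* Main.v *)
Require Import Defs.
From mathcomp Require Import all_boot all_order all_algebra.
From mathcomp Require Import all_classical all_reals all_analysis.
From mathcomp Require Import ring lra zify.

(**
Write a_k for the parameter of the edge leaving compartment k, l_k for its leak
(zero except at one compartment at most), and d_k = a_k + l_k. In the code these
are flow, leak_param and outflow. Expanding the cyclic determinant and its
minors (det_cyclic_mx, cofactor_cyclic_mx), the equation of an output i has the
left-hand side  prod_k (X + d_k) - prod_k a_k,  and the coefficient polynomial
of an input j is  kappa * prod_(k in O) (X + d_k),  where kappa is the product
of the a_k along the path from j to i and O is the set of compartments strictly
between i and j on the way back. Already one such pair of equations determines
all parameters locally, as follows.

Let two parameter vectors x and y have the same coefficients. Their left-hand
sides show that the polynomials prod_k (X + d_k) of x and y differ by a constant,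
namely the difference of the products of the a_k. This constant vanishes:
- if O is nonempty, because the right-hand sides provide a common root of the
  two polynomials;
- if O is empty, kappa is the product of the a_k for k <> i, and it is known.
  The constant terms then give l_i, and evaluating the left-hand sides at the
  root -d_i(y) gives
    (d_i(x) - d_i(y)) * (prod_(m <> i) (d_m(x) - d_i(y)) - kappa) = 0,
  whose second factor is nonzero for generic x and nearby y.
Hence x and y have the same multiset of d_k, and for x and y close to a common
point with distinct d_k this forces d_k(x) = d_k(y) for every k. Finally
a_k = d_k at the compartments without leak, and the product of the a_k gives the
remaining one.

All the genericity used here is the nonvanishing of one two-point polynomial
separation i x y; coefficient_map_separated is the argument above. If
separation i v v <> 0 then, by continuity, separation i x y <> 0 for x and y in
a neighborhood of v, and the coefficient map is injective there. The exceptional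
set is therefore the zero set of v |-> separation i v v.

That this zero set is null rests on lebesgue_null_affine: a continuous function
which is affine in one coordinate vanishes on a null set outside the zeros of
its slope. Each compact piece of that set is the graph of a continuous function,
and a fine grid on the other coordinates covers such a graph by boxes of small
total volume. Each factor of separation is affine in some a_k; for the last
factor the slope in a_k is the same expression with k omitted, so an induction
applies (lebesgue_null_eq_prod).
*)

Set Implicit Arguments.
Unset Strict Implicit.
Unset Printing Implicit Defensive.

Import Order.TTheory GRing.Theory Num.Theory.
Import numFieldNormedType.Exports.

Local Open Scope classical_set_scope.
Local Open Scope ring_scope.

(** * Null sets *)

Section NullSets.
Variables (R : realType) (m : nat).
Implicit Types (x y a b : 'rV[R]_m) (N K : set 'rV[R]_m).

Definition box a b : set 'rV[R]_m := [set x | forall i, a 0 i <= x 0 i <= b 0 i].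
Definition volume a b : R := \prod_i (b 0 i - a 0 i).

Lemma volume_ge0 a b : (forall i, a 0 i <= b 0 i) -> 0 <= volume a b.
Proof. by move=> ab; apply: prodr_ge0 => i _; rewrite subr_ge0. Qed.

(** Covers may be indexed by any countable type, which makes it possible to merge
    covers without choosing enumerations. *)
Lemma lebesgue_null_countable N :
  (forall e : R, 0 < e ->
    exists (T : countType) (J : set T) (a b : T -> 'rV[R]_m),
      [/\ forall t i, J t -> a t 0 i <= b t 0 i,
          N `<=` \bigcup_(t in J) box (a t) (b t)
        & (\esum_(t in J) (volume (a t) (b t))%:E <= e%:E)%E]) ->
  lebesgue_null N.
Proof.
move=> cover e /cover[T [J [a [b [ab Nab leJe]]]]].
pose D k := `[< (pickle @` J) k >].
pose ext (c : T -> 'rV[R]_m) k := if unpickle k is Some t then c t else 0.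
have extE c t : ext c (pickle t) = c t by rewrite /ext pickleK.
exists D, (ext a), (ext b); split=> [k i /asboolP[t Jt <-]|x /Nab[t Jt tx]|].
- by rewrite !extE ab.
- by exists (pickle t); [apply/asboolP; exists t | rewrite /= !extE].
rewrite nneseries_esum => [|k /asboolP[t Jt <-]]; last first.
  by rewrite !extE lee_fin volume_ge0// => i; exact: ab.
rewrite (@reindex_esum _ _ _ J _ pickle).
  by under eq_esum do rewrite !extE.
split=> [t Jt|s t _ _|k /asboolP//].
  by apply/asboolP; exists t.
exact: (pcan_inj pickleK).
Qed.

Lemma lebesgue_null_finite N :
  (forall e : R, 0 < e ->
    exists (T : finType) (a b : T -> 'rV[R]_m),
      [/\ forall t i, a t 0 i <= b t 0 i,
          forall x, N x -> exists t, box (a t) (b t) x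
        & \sum_t volume (a t) (b t) <= e]) ->
  lebesgue_null N.
Proof.
move=> cover; apply: lebesgue_null_countable => e /cover[T [a [b [ab Nab leTe]]]].
exists T, setT, a, b; split=> [//|x /Nab[t tx]|]; first by exists t.
have -> : (setT : set (T : countType)) = [set` index_enum T].
  by apply/seteqP; split=> // t _ /=; rewrite mem_index_enum.
rewrite esum_fset//; last first.
  by move=> t _; rewrite lee_fin volume_ge0.
rewrite -(fsbig_seq _ (fun t => (volume (a t) (b t))%:E)) ?index_enum_uniq//.
by rewrite sumEFin lee_fin.
Qed.

Lemma lebesgue_null_sub N K : N `<=` K -> lebesgue_null K -> lebesgue_null N.
Proof.
move=> NK nullK e /nullK[D [a [b [ab Kab leDe]]]].
by exists D, a, b; split=> // x /NK/Kab.
Qed.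

Lemma lebesgue_null_bigcup (F : nat -> set 'rV[R]_m) :
  (forall k, lebesgue_null (F k)) -> lebesgue_null (\bigcup_k F k).
Proof.
move=> nullF; apply: lebesgue_null_countable => e e_gt0.
have ek_gt0 k : 0 < e / (2 ^ k.+1)%:R.
  by rewrite divr_gt0// ltr0n expn_gt0.
have /choice[D /choice[a /choice[b Dab]]] k := nullF k _ (ek_gt0 k).
exists (nat * nat)%type, (setT `*`` (fun k => [set i | D k i])),
  (fun t => a t.1 t.2), (fun t => b t.1 t.2); split.
- by move=> [k i] j /= [_ Dki]; have [+ _ _] := Dab k; apply.
- move=> x [k _ Fkx]; have [_ /(_ x Fkx)[i Dki kix] _] := Dab k.
  by exists (k, i).
rewrite -(@esum_esum _ _ _ setT (fun k => [set i | D k i])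
  (fun k i => (volume (a k i) (b k i))%:E)); last first.
  move=> k i _ Dki; rewrite lee_fin volume_ge0// => j.
  by have [+ _ _] := Dab k; apply.
apply: le_trans (epsilon_trick0 xpredT (ltW e_gt0)).
rewrite nneseries_esumT; last by move=> k; rewrite lee_fin ltW.
apply: le_esum => k _; have [abk _] := Dab k; apply: le_trans.
rewrite nneseries_esum// => i Dki.
by rewrite lee_fin volume_ge0// => j; exact: abk.
Qed.

Lemma lebesgue_null0 : lebesgue_null (set0 : set 'rV[R]_m).
Proof.
apply: lebesgue_null_finite => e e_gt0; exists void, (fun=> 0), (fun=> 0).
by split=> //; rewrite big1 ?ltW// => -[].
Qed.

Lemma lebesgue_nullU N K :
  lebesgue_null N -> lebesgue_null K -> lebesgue_null (N `|` K).
Proof.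
move=> nullN nullK.
apply: (@lebesgue_null_sub _ (\bigcup_k if k is 0%N then N else K)).
  by move=> x [Nx|Kx]; [exists 0%N | exists 1%N].
by apply: lebesgue_null_bigcup => -[].
Qed.

End NullSets.

Lemma lebesgue_null_bigcup_countable (R : realType) d (T : countType)
    (F : T -> set 'rV[R]_d) :
  (forall t, lebesgue_null (F t)) -> lebesgue_null (\bigcup_t F t).
Proof.
move=> nullF.
apply: (@lebesgue_null_sub _ _ _
  (\bigcup_k if unpickle k is Some t then F t else set0)).
  by move=> x [t _ Ftx]; exists (pickle t) => //; rewrite pickleK.
apply: lebesgue_null_bigcup => k; case: unpickle => [t|]; first exact: nullF.
exact: lebesgue_null0.
Qed.

(** * Null sets of graph type *)

Lemma unit_interval_cell (R : realType) K (z : R) :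
  0 <= z <= K.+1%:R -> exists k : 'I_K.+1, k%:R <= z <= k.+1%:R.
Proof.
elim: K => [|K IHK] /andP[z_ge0 z_le]; first by exists ord0; rewrite z_ge0.
have [zK|Kz] := leP z K.+1%:R; last by exists ord_max; rewrite /= ltW.
have [|k kz] := IHK; first by rewrite z_ge0.
by exists (widen_ord (leqnSn _) k).
Qed.

Lemma interval_cell (R : realType) K (B y : R) : 0 < B -> `|y| <= B ->
  exists k : 'I_K.+1, - B + k%:R * (2 * B / K.+1%:R) <= y
                      <= - B + k.+1%:R * (2 * B / K.+1%:R).
Proof.
move=> B_gt0; rewrite ler_norml => /andP[yl yr].
set h := 2 * B / K.+1%:R.
have h_gt0 : 0 < h by rewrite !mulr_gt0// invr_gt0 ltr0n.
have [|k /andP[kl kr]] := @unit_interval_cell R K ((y + B) / h).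
  rewrite divr_ge0 ?(ltW h_gt0)//=; last by rewrite -lerBlDr sub0r.
  rewrite ler_pdivrMr// /h mulrC divfK ?pnatr_eq0//; lra.
exists k; move: kl kr; rewrite ler_pdivlMr// ler_pdivrMr//; lra.
Qed.

(** Cut the cube [-B, B]^(m-1) of the coordinates other than s into cells of side
    at most delta. Above each cell, N lies within eta of the height of any one of
    its points, so it fits in a box of height 2 * eta; the total volume is
    (2B)^(m-1) * 2 * eta, however fine the grid is. *)
Lemma lebesgue_null_thin (R : realType) (m : nat) (s : 'I_m) (N : set 'rV[R]_m) (B : R) :
    0 < B -> (forall x i, N x -> `|x 0 i| <= B) ->
    (forall eta : R, 0 < eta -> exists2 delta : R, 0 < delta &
      forall x y, N x -> N y ->
        (forall j, j != s -> `|x 0 j - y 0 j| <= delta) ->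
        `|x 0 s - y 0 s| <= eta) ->
  lebesgue_null N.
Proof.
case: m s N => [[]//|m] s N B_gt0 NB thin.
apply: lebesgue_null_finite => e e_gt0.
pose eta := e / (2 * (2 * B) ^+ m).
have eta_gt0 : 0 < eta by rewrite divr_gt0// !mulr_gt0// exprn_gt0// mulr_gt0.
have [delta delta_gt0 Ndelta] := thin _ eta_gt0.
pose K := Num.truncn (2 * B / delta).
pose h : R := 2 * B / K.+1%:R.
have h_gt0 : 0 < h by rewrite !mulr_gt0// invr_gt0 ltr0n.
have h_le : h <= delta.
  rewrite ler_pdivrMr ?ltr0n// [leRHS]mulrC -ler_pdivrMr// ltW//.
  exact: truncnS_gt.
pose cell (t : {ffun 'I_m -> 'I_K.+1}) : set 'rV[R]_m.+1 := [set x | N x /\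
  forall j, - B + (t j)%:R * h <= x 0 (lift s j) <= - B + (t j).+1%:R * h].
(* a point of N above the cell t; over an empty cell, the default 0 gives one more
   box of the same volume *)
pose p t := xget 0 (cell t).
pose a (t : {ffun 'I_m -> 'I_K.+1}) : 'rV[R]_m.+1 := \row_i
  if unlift s i is Some j then - B + (t j)%:R * h else p t 0 s - eta.
pose b (t : {ffun 'I_m -> 'I_K.+1}) : 'rV[R]_m.+1 := \row_i
  if unlift s i is Some j then - B + (t j).+1%:R * h else p t 0 s + eta.
exists {ffun 'I_m -> 'I_K.+1}, a, b; split.
- move=> t i; rewrite !mxE; case: unlift => [j|]; last lra.
  by rewrite lerD2l ler_pM2r// ler_nat.
- move=> x Nx.
  have /choice[t tx] (j : 'I_m) := @interval_cell R K B _ B_gt0 (NB x (lift s j) Nx).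
  exists (finfun t) => i.
  have cellx : cell (finfun t) x by split=> // j; rewrite ffunE.
  have [Np cellp] : cell (finfun t) (p (finfun t)).
    by rewrite /p; case: xgetP => [y _ //|/(_ x)/(_ cellx)].
  rewrite !mxE; case: unliftP => [j ->|->]; first by rewrite ffunE.
  rewrite -ler_distl; apply: Ndelta => // j; case: (unliftP s j) => [k ->|->].
    move=> _; have := tx k; have := cellp k; rewrite ffunE -/h.
    rewrite -!natr1 => /andP[? ?] /andP[? ?].
    by rewrite ler_norml; apply/andP; split; lra.
  by rewrite eqxx.
- have vol t : volume (a t) (b t) = 2 * eta * h ^+ m.
    rewrite /volume (bigD1_ord s)//= !mxE unlift_none.
    congr (_ * _); first lra.
    under eq_bigr do rewrite !mxE liftK -natr1.
    rewrite -[in RHS](card_ord m) -prodr_const; apply: eq_bigr => i _; lra.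
  under eq_bigr do rewrite vol.
  rewrite sumr_const card_ffun !card_ord -mulrnAr -(mulr_natr _ (_ ^ _)) natrX -exprMn.
  rewrite /h divfK ?pnatr_eq0// /eta.
  have /gt_eqF/negbT : 0 < (2 * B) ^+ m by rewrite exprn_gt0// mulr_gt0.
  by move=> B_neq0; rewrite le_eqVlt; apply/orP; left; apply/eqP; field.
Qed.

Lemma entry_le_norm (R : realType) m (x : 'rV[R]_m) i : `|x 0 i| <= `|x|.
Proof.
rewrite [leRHS]/Num.norm /= mx_normrE.
by apply: (le_bigmax _ (fun ij => `|x ij.1 ij.2|) (0, i)).
Qed.

Definition agree_off (R : realType) m (s : 'I_m) (x y : 'rV[R]_m) : Prop :=
  forall j, j != s -> x 0 j = y 0 j.

(** On a compact graph the height is uniformly continuous: among the pairs of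
    points whose heights differ by at least eta, the distance phi of the base
    points attains a minimum, which is positive because the projection along s
    is injective. *)
Lemma lebesgue_null_compact_graph (R : realType) m (s : 'I_m) (K : set 'rV[R]_m) :
  compact K ->
  (forall x y, K x -> K y -> agree_off s x y -> x 0 s = y 0 s) ->
  lebesgue_null K.
Proof.
move=> cK graphK; have [M [Mreal normK]] := compact_bounded cK.
pose B := `|M| + 1.
have B_gt0 : 0 < B by rewrite ltr_wpDl.
apply: (@lebesgue_null_thin _ _ s _ B B_gt0) => [x i Kx|eta eta_gt0].
  apply: le_trans (entry_le_norm _ _) _; apply: normK Kx.
  by apply: le_lt_trans (ler_norm _) _; rewrite /B ltrDl.
have cont_dist j : continuous
    (fun p : 'rV[R]_m * 'rV[R]_m => `|p.1 0 j - p.2 0 j|).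
  move=> p; apply: cvg_norm; apply: cvgB.
    apply: (@continuous_comp _ _ _ fst (fun x : 'rV[R]_m => x 0 j)).
      exact: cvg_fst.
    exact: coord_continuous.
  apply: (@continuous_comp _ _ _ snd (fun x : 'rV[R]_m => x 0 j)).
    exact: cvg_snd.
  exact: coord_continuous.
pose far := (K `*` K) `&` [set p : 'rV[R]_m * 'rV[R]_m | eta <= `|p.1 0 s - p.2 0 s|].
have cfar : compact far.
  apply: compact_closedI; first exact: compact_setX.
  exact: (proj1 (continuous_closedP _) (cont_dist s) _ (@closed_ge _ eta)).
pose phi (p : 'rV[R]_m * 'rV[R]_m) := \sum_(j | j != s) `|p.1 0 j - p.2 0 j|.
have cphi : {within far, continuous phi}.
  apply: continuous_subspaceT; apply: continuous_big => //.
  exact: add_continuous.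
have phi_gt0 p : far p -> 0 < phi p.
  case: p => x y [[/= Kx Ky] etaxy]; rewrite lt_neqAle sumr_ge0// andbT.
  apply: contraTneq etaxy => /esym/eqP.
  rewrite psumr_eq0// => /allP phi0; rewrite -ltNge.
  rewrite (graphK x y)// ?subrr ?normr0// => j js.
  have := phi0 j (mem_index_enum _); rewrite js /= normr_eq0 subr_eq0.
  by move=> /eqP.
have [c c_gt0 phi_ge] : exists2 c, 0 < c & forall p, far p -> c <= phi p.
  have [far0|/set0P farN0] := eqVneq far set0.
    by exists 1 => // p; rewrite far0.
  have [p /set_mem farp minp] := compact_EVT_min farN0 cfar cphi.
  by exists (phi p) => [|q farq]; [exact: phi_gt0 | apply: minp; exact: mem_set].
exists (c / m.+1%:R) => [|x y Kx Ky near_xy]; first by rewrite divr_gt0.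
rewrite leNgt; apply/negP => eta_lt.
have /phi_ge : far (x, y) by split=> //=; exact: ltW.
apply/negP; rewrite -ltNge.
apply: (@le_lt_trans _ _ (\sum_(j < m) c / m.+1%:R)).
  rewrite /phi big_mkcond; apply: ler_sum => j _; case: ifP => [/near_xy//|_].
  by rewrite divr_ge0// ltW.
rewrite sumr_const card_ord -(mulr_natr _ m) mulrAC ltr_pdivrMr// ltr_pM2l//.
by rewrite ltr_nat.
Qed.

(** Where the slope alpha does not vanish, the equation f = 0 determines x_s from
    the other coordinates; the pieces with |alpha| >= 1/(k+1) and |x| <= k are
    compact graphs that exhaust the set. *)
Lemma lebesgue_null_affine (R : realType) m (s : 'I_m) (f alpha : 'rV[R]_m -> R) :
  continuous f -> continuous alpha ->
  (forall x y, agree_off s x y -> f x - f y = alpha x * (x 0 s - y 0 s)) ->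
  lebesgue_null [set x | f x = 0 /\ alpha x != 0].
Proof.
move=> cf calpha affine.
pose K k := [set x | f x = 0] `&` [set x | k.+1%:R^-1 <= `|alpha x|]
            `&` [set x : 'rV[R]_m | `|x| <= k%:R].
apply: (@lebesgue_null_sub _ _ _ (\bigcup_k K k)) => [x [/= fx0 alphax]|].
  have alphax_gt0 : 0 < `|alpha x| by rewrite normr_gt0.
  pose r := Num.max `|x| `|alpha x|^-1.
  have := truncnS_gt r; rewrite gt_max => /andP[xk alphak].
  exists (Num.truncn r).+1 => //; split; last exact: ltW.
  split=> //=; rewrite invf_ple ?posrE// ltW// (lt_le_trans alphak)//.
  by rewrite ler_nat.
apply: lebesgue_null_bigcup => k; apply: (@lebesgue_null_compact_graph _ _ s).
  apply: bounded_closed_compact.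
    by exists k%:R; split=> // M kM x [_ /= xk]; apply: le_trans xk (ltW kM).
  apply: closedI; first apply: closedI.
  - exact: (proj1 (continuous_closedP _) cf _ (@closed_eq _ 0)).
  - have cnorm : continuous (fun x => `|alpha x|).
      move=> x; apply: (@continuous_comp _ _ _ alpha Num.norm); first exact: calpha.
      exact: norm_continuous.
    exact: (proj1 (continuous_closedP _) cnorm _ (@closed_ge _ k.+1%:R^-1)).
  - have cnorm : continuous (fun x : 'rV[R]_m => `|x|).
      by move=> x; exact: norm_continuous.
    exact: (proj1 (continuous_closedP _) cnorm _ (@closed_le _ k%:R)).
move=> x y [[/= fx0 alphax] _] [[/= fy0 _] _] /affine.
rewrite fx0 fy0 subrr => /esym/eqP; rewrite mulf_eq0 => /orP[/eqP alpha0|].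
  by move: alphax; rewrite alpha0 normr0 leNgt invr_gt0 ltr0n.
by rewrite subr_eq0 => /eqP.
Qed.

Lemma lebesgue_null_affine_cst (R : realType) m (s : 'I_m) (c : R)
    (f : 'rV[R]_m -> R) : c != 0 -> continuous f ->
  (forall x y, agree_off s x y -> f x - f y = c * (x 0 s - y 0 s)) ->
  lebesgue_null [set x | f x = 0].
Proof.
move=> c_neq0 cf affine.
apply: (@lebesgue_null_sub _ _ _ [set x | f x = 0 /\ c != 0]) => //.
apply: (@lebesgue_null_affine _ _ s f (fun=> c)) => //.
exact: cst_continuous.
Qed.

(** * Determinant and cofactors of a cyclic matrix *)

Section CyclicMatrix.
Variable n : nat.
Implicit Types i j k r : 'I_n.+1.

(** The entries are added rather than selected by cases, so that the formulas for
    the determinant and the cofactors hold for a single compartment as well,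
    where the diagonal and the cycle coincide. *)
Definition cyclic_mx (R : comNzRingType) (d a : 'I_n.+1 -> R) : 'M[R]_n.+1 :=
  \matrix_(i, j) (d i *+ (i == j) - a j *+ (i == ordS j)).

Lemma ordSE k : ordS k = (if k == n :> nat then 0 else k.+1)%N :> nat.
Proof.
rewrite /=; have := ltn_ord k; case: eqP => [-> _|kn ?]; first by rewrite modnn.
by rewrite modn_small//; lia.
Qed.

(** The determinant is linear in the first row, whose two entries lead to a lower
    triangular matrix L and, after deleting the first row and the last column,
    to an upper triangular one. *)
Lemma det_cyclic_mx (R : comNzRingType) (d a : 'I_n.+1 -> R) :
  \det (cyclic_mx d a) = \prod_i d i - \prod_i a i.
Proof.
pose L : 'M[R]_n.+1 := \matrix_(i, j) (d i *+ (i == j) - a j *+ (i == j.+1 :> nat)).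
pose C : 'M[R]_n.+1 := \matrix_(i, j)
  if i == 0 then (j == ord_max)%:R else L i j.
have succE i j : i != 0 -> (i == ordS j) = (i == j.+1 :> nat).
  rewrite -!val_eqE [val (ordS j)]ordSE => i0; have {}i0 : (i != 0%N :> nat) by [].
  by have := ltn_ord i; case: (eqVneq (j : nat) n) => /=; lia.
rewrite (@determinant_multilinear _ _ (cyclic_mx d a) L C 0 1 (- a ord_max)).
- congr (_ + _).
    rewrite mul1r det_trig; last first.
      apply/is_trig_mxP => i j ij; rewrite mxE -val_eqE /=.
      rewrite (ltn_eqF ij) (_ : (_ == _.+1) = false) ?subr0//; apply/negbTE; lia.
    apply: eq_bigr => i _; rewrite mxE eqxx (_ : (_ == _.+1) = false) ?subr0//.
    by apply/negbTE; lia.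
  rewrite (expand_det_row _ 0) (bigD1 ord_max)//= big1 => [|j /negbTE jmax]; last first.
    by rewrite mxE /= jmax mul0r.
  have CE (i j : 'I_n) : row' 0 (col' ord_max C) i j =
      d (lift 0 i) *+ (i.+1 == j :> nat) - a (lift ord_max j) *+ (i == j :> nat).
    rewrite !mxE /= -val_eqE /= [bump n j]/bump leqNgt ltn_ord add0n.
    by rewrite /bump leq0n add1n eqSS.
  rewrite addr0 mxE !eqxx mul1r /cofactor -det_tr det_trig; last first.
    apply/is_trig_mxP => i j ij; rewrite [LHS]mxE CE.
    by rewrite (gtn_eqF ij) (gtn_eqF (leqW ij)) subr0.
  rewrite (eq_bigr (fun i : 'I_n => - a (lift ord_max i))) => [|i _]; last first.
    by rewrite [LHS]mxE CE eqxx (gtn_eqF (ltnSn i)) sub0r.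
  rewrite prodrN cardT size_enum_ord add0n signrMK mulNr.
  by rewrite (bigD1_ord ord_max).
- have row0E j : (0 == ordS j) = (j == ord_max).
    by rewrite -!val_eqE [val (ordS j)]ordSE /=; case: ifP.
  apply/rowP => j; rewrite !mxE row0E mul1r /= mulr0n subr0.
  have [->|_] := eqVneq j ord_max; first by rewrite mulr1.
  by rewrite !mulr0n mulr0 subr0 addr0.
- by apply/matrixP => i j; rewrite !mxE succE.
- by apply/matrixP => i j; rewrite !mxE succE.
Qed.

(** The number of steps from j to k along the cycle. *)
Definition cycle_dist j k : nat := if (j <= k)%N then (k - j)%N else (k + n.+1 - j)%N.

Lemma cycle_dist_inj j : injective (cycle_dist j).
Proof.
move=> k k' eqd; apply: val_inj; move: eqd; rewrite /cycle_dist /=.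
have := ltn_ord k; have := ltn_ord k'; have := ltn_ord j.
by case: (leqP j k); case: (leqP j k'); lia.
Qed.

Lemma cycle_dist_le j k : (cycle_dist j k <= n)%N.
Proof.
have := ltn_ord k; have := ltn_ord j; rewrite /cycle_dist.
by case: (leqP j k); lia.
Qed.

Lemma cycle_distnn j : cycle_dist j j = 0%N.
Proof. by rewrite /cycle_dist leqnn subnn. Qed.

Lemma cycle_distS j k : ordS k != j -> cycle_dist j (ordS k) = (cycle_dist j k).+1.
Proof.
rewrite -val_eqE [val (ordS k)]ordSE /cycle_dist ordSE.
have := ltn_ord k; have := ltn_ord j; case: (eqVneq (k : nat) n) => kn.
  by case: (leqP j k); case: (leqP j 0%N) => /=; lia.
by case: (leqP j k); case: (leqP j k.+1) => /=; lia.
Qed.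

Lemma cycle_dist_pred k : cycle_dist (ordS k) k = n.
Proof.
rewrite /cycle_dist ordSE; have := ltn_ord k; case: (eqVneq (k : nat) n) => [-> _|_ _].
  by rewrite leq0n subn0.
by rewrite ltnn; lia.
Qed.

Section Cofactor.
Variables (R : idomainType) (d a : 'I_n.+1 -> R).

(** The candidate for the (j, i) cofactor: off-diagonal entries along the path from
    j to i, diagonal entries on the rest of the cycle, i itself excluded. *)
Definition path_weight j i : R :=
  (\prod_(k | (cycle_dist j k < cycle_dist j i)%N) a k)
  * \prod_(k | (cycle_dist j i < cycle_dist j k)%N) d k.

Lemma path_weightS j k : ordS k != j ->
  d (ordS k) * path_weight j (ordS k) = a k * path_weight j k.
Proof.
move=> Skj; rewrite /path_weight (cycle_distS Skj) (bigD1 k)//=.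
rewrite [X in _ = _ * (_ * X)](bigD1 (ordS k)) ?cycle_distS//=.
have before l : ((cycle_dist j l < (cycle_dist j k).+1) && (l != k))%N
    = (cycle_dist j l < cycle_dist j k)%N.
  by rewrite -(inj_eq (@cycle_dist_inj j)) ltnS ltn_neqAle andbC.
have after l : ((cycle_dist j k < cycle_dist j l) && (l != ordS k))%N
    = ((cycle_dist j k).+1 < cycle_dist j l)%N.
  by rewrite -(inj_eq (@cycle_dist_inj j)) cycle_distS// andbC [RHS]ltn_neqAle eq_sym.
rewrite (eq_bigl _ _ before) (eq_bigl _ _ after).
by ring.
Qed.

Lemma path_weight_start j : d j * path_weight j j = \prod_k d k.
Proof.
rewrite /path_weight cycle_distnn big_pred0// mul1r [RHS](bigD1 j)//=; congr (_ * _).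
apply: eq_bigl => k; rewrite -(inj_eq (@cycle_dist_inj j)) cycle_distnn.
by rewrite lt0n.
Qed.

Lemma path_weight_end k : a k * path_weight (ordS k) k = \prod_k a k.
Proof.
rewrite /path_weight cycle_dist_pred [X in _ * (_ * X)]big_pred0 ?mulr1 => [|l]; last first.
  by rewrite ltnNge cycle_dist_le.
rewrite [RHS](bigD1 k)//=; congr (_ * _); apply: eq_bigl => l.
by rewrite -(inj_eq (@cycle_dist_inj (ordS k))) cycle_dist_pred ltn_neqAle cycle_dist_le andbT.
Qed.

(** Row r of the product involves only r and its predecessor on the cycle, and
    path_weight is multiplicative along the cycle; the two terms therefore cancel
    except at the start j, where the whole cycle has been traversed. *)
Lemma cyclic_mx_path_weight j :
  cyclic_mx d a *m \col_i path_weight j i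
  = \col_i (\det (cyclic_mx d a) *+ (i == j)).
Proof.
apply/colP => r; rewrite !mxE.
pose k := ord_pred r; have rE : r = ordS k by rewrite ord_predK.
have -> : \sum_l cyclic_mx d a r l * (\col_i path_weight j i) l 0
    = d r * path_weight j r - a k * path_weight j k.
  under eq_bigr do rewrite !mxE mulrBl.
  rewrite big_split /= sumrN (bigD1 r)//= eqxx big1 => [|l /negbTE]; last first.
    by rewrite eq_sym => ->; rewrite mul0r.
  rewrite (bigD1 k)//= -rE eqxx big1 ?addr0// => l lk.
  by rewrite rE (inj_eq (@ordS_inj _)) eq_sym (negbTE lk) mul0r.
rewrite rE; have [<-|Skj] := eqVneq (ordS k) j.
  by rewrite path_weight_start path_weight_end det_cyclic_mx.
by rewrite path_weightS// subrr.
Qed.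

(** The adjugate solves the same linear system, whose solution is unique. *)
Lemma cofactor_cyclic_mx j i : \det (cyclic_mx d a) != 0 ->
  cofactor (cyclic_mx d a) j i = path_weight j i.
Proof.
move=> det_neq0; have := congr1 (mulmx (\adj (cyclic_mx d a))) (cyclic_mx_path_weight j).
rewrite mulmxA mul_adj_mx mul_scalar_mx => /colP/(_ i).
rewrite !mxE (bigD1 j)//= big1 => [|k /negbTE kj]; last first.
  by rewrite !mxE kj mulr0.
by rewrite !mxE eqxx addr0 mulrC => /(mulIf det_neq0) <-.
Qed.
End Cofactor.

End CyclicMatrix.

(** * The equations of a cycle model *)

Section CycleModel.
Variables (R : realType) (n : nat) (M : compartmental_model n.+1).
Hypotheses (n_gt0 : (0 < n)%N) (cycleM : cycle_model M).
Implicit Types (v x y : 'rV[R]_#|param M|) (i j k m : 'I_n.+1).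

Definition flow v k : R := edge_param v (ordS k) k.
Definition outflow v k : R := flow v k + leak_param v k.

Lemma cycle_edgeE i j : ((i, j) \in edges M) = (j == ordS i).
Proof.
rewrite cycleM; apply/imsetP/eqP => [[k _ [-> ->]]//|->].
by exists i.
Qed.

Lemma ordS_neq k : ordS k != k.
Proof.
rewrite -val_eqE [val (ordS k)]ordSE.
by case: (eqVneq (k : nat) n) => /= [->|_]; [rewrite neq_ltn n_gt0 | lia].
Qed.

Lemma char_poly_mx_cycle v :
  char_poly_mx (compartmental_matrix v)
  = cyclic_mx (fun k => 'X + (outflow v k)%:P) (fun k => (flow v k)%:P).
Proof.
apply/matrixP => i j; rewrite !mxE; have [<-|ij] := eqVneq i j.
  rewrite [i == ordS i]eq_sym (negbTE (ordS_neq _)) subr0 mulr1n.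
  rewrite (big_pred1 (ordS i)) => [|k]; last by rewrite cycle_edgeE.
  by rewrite -polyCN opprD !opprK /outflow mulr1n [leak_param _ _ + _]addrC.
rewrite mulr0n !sub0r; have [->|iSj] := eqVneq i (ordS j); first by [].
by rewrite /edge_param insubF ?cycle_edgeE ?(negbTE iSj)// oppr0.
Qed.

Lemma output_polyE v :
  output_poly v = \prod_k ('X + (outflow v k)%:P) - (\prod_k flow v k)%:P.
Proof. by rewrite /output_poly char_poly_mx_cycle det_cyclic_mx rmorph_prod. Qed.

Lemma output_poly_size v : size (output_poly v) = n.+2.
Proof. exact: size_char_poly. Qed.

(** The leading coefficient of the polynomial applied to the input j. *)
Definition path_flow v j i : R :=
  \prod_(k | (cycle_dist j k < cycle_dist j i)%N) flow v k.

Lemma input_polyE v i j :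
  input_poly v i j = (path_flow v j i)%:P
    * \prod_(k | (cycle_dist j i < cycle_dist j k)%N) ('X + (outflow v k)%:P).
Proof.
rewrite /path_flow rmorph_prod.
rewrite -[RHS](@cofactor_cyclic_mx _ {poly R} (fun k => 'X + (outflow v k)%:P)
  (fun k => (flow v k)%:P)).
  by rewrite -char_poly_mx_cycle /cofactor addnC.
by rewrite -char_poly_mx_cycle -size_poly_eq0 -/(output_poly v) output_poly_size.
Qed.

Lemma input_poly_size v i j : (size (input_poly v i j) <= n.+2)%N.
Proof.
rewrite input_polyE mul_polyC; apply: leq_trans (size_scale_leq _ _) _.
apply: leq_trans (size_prod_leq _ _) _.
rewrite (eq_bigr (fun=> 2%N)) => [|k _]; last by rewrite size_XaddC.
rewrite sum_nat_const leq_subLR muln2 -addnn -addnS; apply: leq_add => //.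
by rewrite ltnS -[leqRHS](card_ord n.+1) max_card.
Qed.

(** The coefficients omitted from the coefficient map are constant, so nothing is
    lost: equal values of the map mean equal coefficients at all addresses. *)
Lemma io_coef_eq x y (q : coef_address n.+1) :
  coefficient_map x = coefficient_map y -> occurs M q ->
  io_coef x q = io_coef y q.
Proof.
move=> eq_c occq; have [|] := boolP (q \in coef_index M R).
  move=> qI; have /rowP/(_ (enum_rank_in qI q)) := eq_c.
  by rewrite !mxE enum_rankK_in.
rewrite inE occq /= negb_and !negbK => /orP[]/asboolP c; by rewrite !c.
Qed.

Lemma eq_output_poly x y i : i \in Out M ->
  coefficient_map x = coefficient_map y -> output_poly x = output_poly y.
Proof.
move=> iOut eq_c; apply/polyP => k; have [kn|nk] := ltnP k n.+2; last first.
  by rewrite !nth_default ?output_poly_size.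
by apply: (@io_coef_eq x y (i, None, Ordinal kn) eq_c); rewrite /= iOut.
Qed.

Lemma eq_input_poly x y i j : i \in Out M -> j \in In M ->
  coefficient_map x = coefficient_map y -> input_poly x i j = input_poly y i j.
Proof.
move=> iOut jIn eq_c; apply/polyP => k; have [kn|nk] := ltnP k n.+2; last first.
  by rewrite !nth_default//; apply: leq_trans nk; exact: input_poly_size.
by apply: (@io_coef_eq x y (i, Some j, Ordinal kn) eq_c); rewrite /= iOut.
Qed.

Lemma leak_param_eq0 v k : k \notin Leak M -> leak_param v k = 0.
Proof. by move=> kL; rewrite /leak_param insubF//; exact/negbTE. Qed.

Lemma outflow_noleak v k : k \notin Leak M -> outflow v k = flow v k.
Proof. by move=> kL; rewrite /outflow leak_param_eq0// addr0. Qed.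

Lemma params_eq x y :
  (forall k, flow x k = flow y k) -> (forall k, outflow x k = outflow y k) ->
  x = y.
Proof.
move=> flow_eq out_eq; apply/rowP => r; rewrite -(enum_valK r).
case: (enum_val r) => [e|l].
  have edgeE v : edge_param v (val e).2 (val e).1 = v 0 (enum_rank (inl e : param M)).
    by rewrite /edge_param -surjective_pairing valK.
  have := flow_eq (val e).1; rewrite /flow.
  have := valP e; rewrite [val e]surjective_pairing cycle_edgeE => /eqP <-.
  by rewrite !edgeE.
have := out_eq (val l); rewrite /outflow flow_eq => /addrI.
by rewrite /leak_param valK.
Qed.

(** The genericity condition, with two points: x and y are meant to be close to a
    common v. The first factor makes all flows nonzero; the second says that the
    outflows of x and y can only agree at equal compartments; the third multiplies
    outflow x i - outflow y i in the equation obtained when the path from the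
    input to i runs through all compartments. *)
Definition separation i x y : R :=
  (\prod_k flow x k)
  * (\prod_k \prod_(m | m != k) (outflow x k - outflow y m))
  * (\prod_(m | m != i) (outflow x m - outflow y i) - \prod_(m | m != i) flow x m).

Lemma horner_outflow (P : pred 'I_n.+1) v z :
  (\prod_(k | P k) ('X + (outflow v k)%:P)).[z] = \prod_(k | P k) (z + outflow v k).
Proof. by rewrite horner_prod; apply: eq_bigr => k _; rewrite !hornerE. Qed.

(** The recovery argument. The heart of it is prod_flow_eq: the polynomials
    prod_k (X + outflow_k) of x and y, which a priori differ by a constant, are
    equal. *)
Lemma coefficient_map_separated i j x y :
    i \in Out M -> j \in In M -> (#|Leak M| <= 1)%N -> separation i x y != 0 ->
  coefficient_map x = coefficient_map y -> x = y.
Proof.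
move=> iOut jIn leak_le1; rewrite !mulf_eq0 !negb_or => /andP[/andP[a_neq0 d_neq] sep] eq_c.
have other_noleak k m : k \in Leak M -> m != k -> m \notin Leak M.
  move=> kL; apply: contraNN => mL; apply/eqP.
  by move/card_le1_eqP: leak_le1; apply.
have flow_neq0 k : flow x k != 0 by have /prodf_neq0 := a_neq0; apply.
have outflow_neq k m : m != k -> outflow x k != outflow y m.
  move=> mk; have /prodf_neq0/(_ k isT)/prodf_neq0/(_ m mk) := d_neq.
  by rewrite subr_eq0.
have outE z : \prod_k (z + outflow x k) - \prod_k flow x k
    = \prod_k (z + outflow y k) - \prod_k flow y k.
  have := congr1 (horner^~ z) (eq_output_poly iOut eq_c).
  by rewrite !output_polyE !hornerE !horner_outflow.
pose after k := (cycle_dist j i < cycle_dist j k)%N.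
have inE z : path_flow x j i * \prod_(k | after k) (z + outflow x k)
    = path_flow y j i * \prod_(k | after k) (z + outflow y k).
  have := congr1 (horner^~ z) (eq_input_poly iOut jIn eq_c).
  by rewrite !input_polyE !hornerE !horner_outflow.
have outflow_root v k : \prod_m (- outflow v k + outflow v m) = 0.
  by rewrite (bigD1 k)//= addNr mul0r.
have prod_flow_eq : \prod_k flow x k = \prod_k flow y k.
  have [k ik|no_after] := pickP after.
    (* minus the outflow of k in y is a root of both polynomials *)
    have root_x : \prod_(m | after m) (- outflow y k + outflow x m) = 0.
      have := inE (- outflow y k); rewrite [X in _ = _ * X](bigD1 k)//= addNr.
      rewrite mul0r mulr0 => /eqP; rewrite mulf_eq0 => /orP[|/eqP//].
      by rewrite prodf_seq_eq0 => /hasP[m _ /andP[_]]; rewrite (negbTE (flow_neq0 m)).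
    have := outE (- outflow y k); rewrite outflow_root (bigID after)/= root_x.
    by rewrite mul0r !sub0r => /oppr_inj.
  (* the path from j to i runs through all compartments *)
  have path_flowE v : path_flow v j i = \prod_(m | m != i) flow v m.
    apply: eq_bigl => k; rewrite -(inj_eq (@cycle_dist_inj _ j)).
    by have := no_after k; rewrite /after; case: ltngtP.
  have kappa_eq : \prod_(m | m != i) flow x m = \prod_(m | m != i) flow y m.
    by have := inE 0; rewrite ![\prod_(k | after k) _]big_pred0// !mulr1 !path_flowE.
  have kappa_neq0 : \prod_(m | m != i) flow x m != 0.
    by apply/prodf_neq0 => m _.
  have leak_eq : leak_param x i = leak_param y i.
    have [iL|iL] := boolP (i \in Leak M); last by rewrite !leak_param_eq0.
    have leakE v : \prod_k (0 + outflow v k) - \prod_k flow v k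
        = leak_param v i * \prod_(m | m != i) flow v m.
      rewrite (bigD1 i)//= [X in _ - X](bigD1 i)//= add0r.
      rewrite (eq_bigr (flow v)) => [|m mi]; last first.
        by rewrite add0r outflow_noleak// (other_noleak i).
      by rewrite -mulrBl /outflow addrAC subrr add0r.
    by have := outE 0; rewrite !leakE -kappa_eq => /(mulIf kappa_neq0).
  have := outE (- outflow y i); rewrite outflow_root (bigD1 i)//=.
  rewrite [\prod_k flow x k](bigD1 i)//= [\prod_k flow y k](bigD1 i)//= -kappa_eq.
  rewrite (eq_bigr (fun m => outflow x m - outflow y i)) => [|m _]; last exact: addrC.
  set kappa := \prod_(m | _) flow x m; set delta := \prod_(m | _) _ => eq_delta.
  have : (outflow x i - outflow y i) * (delta - kappa) = 0.
    by move: eq_delta; rewrite /outflow leak_eq => eq_delta; lra.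
  move/eqP; rewrite mulf_eq0 (negbTE sep) orbF subr_eq0 /outflow leak_eq.
  by move=> /eqP/addIr ->.
have outflow_eq k : outflow x k = outflow y k.
  have : \prod_m (- outflow x k + outflow y m) = 0.
    by have := outE (- outflow x k); rewrite outflow_root prod_flow_eq; lra.
  move=> /eqP; rewrite prodf_seq_eq0 => /hasP[m _ /= /eqP root_m].
  have [mk|/outflow_neq/eqP[]] := eqVneq m k; last by lra.
  by rewrite -{2}mk; lra.
apply: params_eq => // k; have [kL|kL] := boolP (k \in Leak M); last first.
  by rewrite -!outflow_noleak.
have flow_eq m : m != k -> flow x m = flow y m.
  move=> mk; have mL := other_noleak k m kL mk.
  by rewrite -!outflow_noleak.
move: prod_flow_eq; rewrite (bigD1 k)//= [RHS](bigD1 k)//= -(eq_bigr _ flow_eq).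
by apply: mulIf; apply/prodf_neq0.
Qed.

Lemma continuous_flow k : continuous (fun v => flow v k).
Proof.
rewrite /flow /edge_param; case: insub => [e|]; last exact: cst_continuous.
exact: coord_continuous.
Qed.

Lemma continuous_outflow k : continuous (fun v => outflow v k).
Proof.
have cont_leak : continuous (fun v => leak_param v k).
  rewrite /leak_param; case: insub => [l|]; first exact: coord_continuous.
  exact: cst_continuous.
move=> v; exact: (cvgD (@continuous_flow k v) (cont_leak v)).
Qed.

Lemma continuous_separation i :
  continuous (fun p : 'rV[R]_#|param M| * 'rV[R]_#|param M| => separation i p.1 p.2).
Proof.
pose V := 'rV[R]_#|param M|.
have flow1 k : continuous (fun p : V * V => flow p.1 k).
  move=> p; apply: (@continuous_comp _ _ _ fst (fun v : V => flow v k)).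
    exact: cvg_fst.
  exact: continuous_flow.
have outflow1 k : continuous (fun p : V * V => outflow p.1 k).
  move=> p; apply: (@continuous_comp _ _ _ fst (fun v : V => outflow v k)).
    exact: cvg_fst.
  exact: continuous_outflow.
have outflow2 k : continuous (fun p : V * V => outflow p.2 k).
  move=> p; apply: (@continuous_comp _ _ _ snd (fun v : V => outflow v k)).
    exact: cvg_snd.
  exact: continuous_outflow.
have cont_diff k m : continuous (fun p : V * V => outflow p.1 k - outflow p.2 m).
  by move=> p; exact: (cvgB (outflow1 k p) (outflow2 m p)).
have cont_prod (P : pred 'I_n.+1) (F : 'I_n.+1 -> V * V -> R) :
    (forall k, continuous (F k)) -> continuous (fun p => \prod_(k | P k) F k p).
  by move=> cF; apply: continuous_big => //; exact: mul_continuous.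
have c1 := cont_prod xpredT _ flow1.
have c2 := cont_prod xpredT _ (fun k => cont_prod (fun m => m != k) _ (cont_diff k)).
have c3 := cont_prod (fun m => m != i) _ (cont_diff^~ i).
have c4 := cont_prod (fun m => m != i) _ flow1.
by move=> p; exact: (cvgM (cvgM (c1 p) (c2 p)) (cvgB (c3 p) (c4 p))).
Qed.

(** Each flow is a free coordinate: it can be moved while the other flows and the
    leaks stay fixed. This provides the directions in which the factors of
    separation are affine. *)
Lemma flow_coordinate k : exists s : 'I_#|param M|,
  (forall v, flow v k = v 0 s) /\
  forall x y, agree_off s x y ->
    (forall m, m != k -> flow x m = flow y m) /\
    (forall m, leak_param x m = leak_param y m).
Proof.
have kE : (k, ordS k) \in edges M by rewrite cycle_edgeE.
exists (enum_rank (inl (Sub (k, ordS k) kE) : param M)).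
split=> [v|x y xy]; first by rewrite /flow /edge_param insubT.
split=> m; last first.
  rewrite /leak_param; case: insub => // l; apply: xy.
  by rewrite (inj_eq enum_rank_inj).
move=> mk; rewrite /flow /edge_param; case: insubP => // e _ eE; apply: xy.
rewrite (inj_eq enum_rank_inj); apply: contraNneq mk => -[eE'].
by move: eE; rewrite eE' /= => -[->].
Qed.

Lemma lebesgue_null_flow0 k :
  lebesgue_null [set v : 'rV[R]_#|param M| | flow v k = 0].
Proof.
have [s [flowE _]] := flow_coordinate k.
apply: (@lebesgue_null_affine_cst _ _ s 1); first exact: oner_neq0.
  exact: continuous_flow.
by move=> x y _; rewrite mul1r !flowE.
Qed.

Lemma lebesgue_null_eq_outflow k m : m != k ->
  lebesgue_null [set v : 'rV[R]_#|param M| | outflow v k - outflow v m = 0].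
Proof.
move=> mk; have [s [flowE agree]] := flow_coordinate k.
apply: (@lebesgue_null_affine_cst _ _ s 1); first exact: oner_neq0.
  by move=> v; exact: (cvgB (@continuous_outflow k v) (@continuous_outflow m v)).
move=> x y /agree[flow_eq leak_eq].
by rewrite /outflow !leak_eq (flow_eq m mk) !flowE; ring.
Qed.

(** With P = prod_(m <- r) (outflow_m - outflow_i) and Q = prod_(m <- r) flow_m, the
    function for k :: r is (outflow_k - outflow_i) * P - flow_k * Q. Both outflow_k
    and flow_k have slope 1 in the flow of k, so the slope is P - Q, the function
    for r. The induction starts at singletons, the empty sequence giving 1 - 1. *)
Lemma lebesgue_null_eq_prod i (r : seq 'I_n.+1) : uniq r -> i \notin r -> r != [::] ->
  lebesgue_null [set v : 'rV[R]_#|param M| |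
    \prod_(m <- r) (outflow v m - outflow v i) - \prod_(m <- r) flow v m = 0].
Proof.
pose f (r : seq 'I_n.+1) v : R :=
  \prod_(m <- r) (outflow v m - outflow v i) - \prod_(m <- r) flow v m.
have cf s : continuous (f s).
  have cdiff m : continuous (fun v => outflow v m - outflow v i).
    by move=> v; exact: (cvgB (@continuous_outflow m v) (@continuous_outflow i v)).
  have cprod1 : continuous (fun v => \prod_(m <- s) (outflow v m - outflow v i)).
    by apply: continuous_big => //; exact: mul_continuous.
  have cprod2 : continuous (fun v => \prod_(m <- s) flow v m).
    apply: continuous_big => [|m _]; first exact: mul_continuous.
    exact: continuous_flow.
  by move=> v; exact: (cvgB (cprod1 v) (cprod2 v)).
elim: r => [//|k r IHr] /= /andP[kr uniq_r]; rewrite inE negb_or => /andP[ik ir] _.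
have [r0|r_neq0] := eqVneq r [::].
  have [s [flowE agree]] := flow_coordinate i.
  have N1_neq0 : (-1 : R) != 0 by rewrite oppr_eq0 oner_neq0.
  rewrite r0; apply: (@lebesgue_null_affine_cst _ _ s _ (f [:: k]) N1_neq0) => //.
  (* f [:: k] is leak_k - outflow_i, whose slope in flow_i is -1 *)
  move=> x y /agree[flow_eq leak_eq].
  rewrite /f !big_cons !big_nil /outflow !leak_eq (flow_eq k); last by rewrite eq_sym.
  by rewrite !flowE; ring.
have [s [flowE agree]] := flow_coordinate k.
apply: (@lebesgue_null_sub _ _ _
  ([set v | f r v = 0] `|` [set v | f (k :: r) v = 0 /\ f r v != 0])).
  by move=> v v0; have [|] := eqVneq (f r v) 0; [left | right].
apply: lebesgue_nullU; first exact: IHr.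
apply: (@lebesgue_null_affine _ _ s) => // x y /agree[flow_eq leak_eq].
have flow_eq_r m : m \in r -> flow x m = flow y m.
  by move=> mr; apply: flow_eq; apply: contraNneq kr => <-.
have outflow_eq m : m != k -> outflow x m = outflow y m.
  by move=> mk; rewrite /outflow flow_eq// leak_eq.
have eq1 : \prod_(m <- r) flow y m = \prod_(m <- r) flow x m.
  by apply: eq_big_seq => m mr; rewrite flow_eq_r.
have eq2 : \prod_(m <- r) (outflow y m - outflow y i)
    = \prod_(m <- r) (outflow x m - outflow x i).
  apply: eq_big_seq => m mr; rewrite !outflow_eq//.
  by apply: contraNneq kr => <-.
rewrite /f !big_cons eq1 eq2 (outflow_eq i)// /outflow leak_eq !flowE.
by ring.
Qed.

Lemma lebesgue_null_separation i :
  lebesgue_null [set v : 'rV[R]_#|param M| | separation i v v = 0].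
Proof.
apply: (@lebesgue_null_sub _ _ _ ((
    (\bigcup_k [set v | flow v k = 0]) `|`
    (\bigcup_k \bigcup_m [set v | m != k /\ outflow v k - outflow v m = 0])) `|`
    [set v | \prod_(m <- rem i (enum 'I_n.+1)) (outflow v m - outflow v i)
             - \prod_(m <- rem i (enum 'I_n.+1)) flow v m = 0])).
  move=> v /eqP; rewrite !mulf_eq0 => /orP[/orP[]|/eqP].
  - by rewrite prodf_seq_eq0 => /hasP[k _ /= /eqP vk]; left; left; exists k.
  - rewrite prodf_seq_eq0 => /hasP[k _ /=].
    rewrite prodf_seq_eq0 => /hasP[m _ /andP[mk /eqP vkm]].
    by left; right; exists k => //; exists m.
  - move=> v0; right => /=; rewrite rem_filter ?enum_uniq//.
    by rewrite !big_filter !big_enum_cond.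
apply: lebesgue_nullU; first apply: lebesgue_nullU.
- by apply: lebesgue_null_bigcup_countable => k; exact: lebesgue_null_flow0.
- apply: lebesgue_null_bigcup_countable => k; apply: lebesgue_null_bigcup_countable => m.
  have [->|mk] := eqVneq m k.
    by apply: lebesgue_null_sub (@lebesgue_null0 _ _) => v [/= /negP].
  by apply: lebesgue_null_sub (lebesgue_null_eq_outflow mk) => v [].
- apply: lebesgue_null_eq_prod; first exact/rem_uniq/enum_uniq.
    by rewrite mem_rem_uniqF ?enum_uniq.
  by rewrite -size_eq0 size_rem ?mem_enum// size_enum_ord -lt0n.
Qed.

Lemma cycle_strongly_connected : strongly_connected M.
Proof.
move=> i j; have [t] := ubnP (cycle_dist i j); elim: t j => // t IHt j.
have [->|ji] := eqVneq j i; first by rewrite connect0.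
rewrite -(ord_predK j) cycle_distS ?ord_predK// ltnS => /IHt ik.
by apply: connect_trans ik (connect1 _); rewrite cycle_edgeE ord_predK.
Qed.

End CycleModel.

Theorem theorem3p5 (R : realType) (n : nat) (M : compartmental_model n) :
  (3 <= n)%N -> cycle_model M ->
  (1 <= #|In M|)%N -> (1 <= #|Out M|)%N -> (#|Leak M| <= 1)%N ->
  generically_locally_identifiable R M.
Proof.
case: n M => [//|n] M n_ge3 cycleM In_gt0 Out_gt0 leak_le1.
have n_gt0 : (0 < n)%N by lia.
split=> //; first exact: cycle_strongly_connected.
have /card_gt0P[j jIn] := In_gt0; have /card_gt0P[i iOut] := Out_gt0.
exists [set v | separation i v v = 0]; split; first exact: lebesgue_null_separation.
move=> v /eqP sep_v.
have [[A B] /= [nA nB] AB] : \forall p \near (v, v), separation i p.1 p.2 != 0.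
  have cont_v := @continuous_separation _ _ M i (v, v).
  exact: cvgr_neq0 _ cont_v sep_v.
exists (A `&` B)°; split; first exact: open_interior.
  exact: filterI.
move=> x y /set_mem/interior_subset[Ax _] /set_mem/interior_subset[_ By].
apply: (@coefficient_map_separated _ _ _ n_gt0 cycleM i j) => //.
exact: (AB (x, y)).
Qed.
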